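(* Let $n\ge 2$, let $\mathbb{F}$ be a finite field, $\mathbb{K}=\mathbb{F}((t^{-1}))$, $G=\mathrm{SL}_n(\mathbb{K})$, $\Gamma=\mathrm{SL}_n(\mathbb{F}[t])$, and let $A$ be the subgroup of $G$ consisting of diagonal matrices. Then $$G=A\,\mathrm{SL}_n(\mathfrak o;\mathfrak p)\,\Gamma,$$ where $\mathrm{SL}_n(\mathfrak o;\mathfrak p)=\{g\in\mathrm{SL}_n(\mathfrak o): g\equiv 1_n \bmod \mathfrak p\}$; that is, every $g\in G$ can be written as $g=ah\gamma$ with $a\in A$, $h\in \mathrm{SL}_n(\mathfrak o;\mathfrak p)$ and $\gamma\in\Gamma$.
   Context: With $q=\#\mathbb{F}$, $\mathbb{K}=\mathbb{F}((t^{-1}))$ carries the ultrametric norm $|\cdot|$ for which $|bt^m|=q^m$ for $b\in\mathbb{F}\setminus\{0\}$, $m\in\mathbb{Z}$. $\mathfrak o=\{\alpha\in\mathbb{K}:|\alpha|\le 1\}$ is its valuation ring and $\mathfrak p=\{\alpha\in\mathbb{K}:|\alpha|<1\}$ is the maximal ideal of $\mathfrak o$. $1_n$ is the identity matrix. *)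

(* Defs.v *)
From HB Require Import structures.
From mathcomp Require Import all_boot all_order all_algebra.
From mathcomp Require Import boolp classical_sets functions cardinality fsbigop.
From mathcomp Require Import zify.

Set Implicit Arguments.
Unset Strict Implicit.
Unset Printing Implicit Defensive.
Import Order.TTheory GRing.Theory Num.Theory.

Local Open Scope classical_set_scope.
Local Open Scope ring_scope.

(* F((t^-1)): [lcoef f m] is the coefficient of t^m in f, so supports are
   bounded above. *)
Record laurent (F : fieldType) := Laurent {
  lcoef :> int -> F;
  lcoef_bounded : exists N : int, forall m, N < m -> lcoef m = 0 }.

HB.instance Definition _ (F : fieldType) := gen_eqMixin (laurent F).
HB.instance Definition _ (F : fieldType) := gen_choiceMixin (laurent F).

Section LaurentRing.
Variable F : fieldType.
Implicit Types f g h : laurent F.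

Definition lbound f (N : int) := forall m, N < m -> f m = 0.

Lemma lbound_ex f : exists N, lbound f N.
Proof. exact: lcoef_bounded. Qed.

Lemma laurentP f g : lcoef f =1 lcoef g -> f = g.
Proof.
case: f g => [f pf] [g pg] /= /funext fg; case: _ / fg pg => pg.
by congr Laurent; exact: Prop_irrelevance.
Qed.

Fact laurent_monom_bounded (c : F) (k : int) :
  exists N : int, forall m, N < m -> (if m == k then c else 0) = 0.
Proof. by exists k => m km; case: eqP => // mk; move: km; rewrite mk ltxx. Qed.
Definition laurent_monom c k := Laurent (laurent_monom_bounded c k).

Definition laurent_zero := laurent_monom 0 0.
Definition laurent_one := laurent_monom 1 0.

Fact laurent_opp_bounded f :
  exists N : int, forall m, N < m -> - f m = 0.
Proof. by have [N fN] := lbound_ex f; exists N => m /fN ->; rewrite oppr0. Qed.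
Definition laurent_opp f := Laurent (laurent_opp_bounded f).

Fact laurent_add_bounded f g :
  exists N : int, forall m, N < m -> f m + g m = 0.
Proof.
have [M fM] := lbound_ex f; have [N gN] := lbound_ex g.
exists (Num.max M N) => m; rewrite gt_max => /andP[/fM -> /gN ->].
by rewrite addr0.
Qed.
Definition laurent_add f g := Laurent (laurent_add_bounded f g).

(* The sum has finite support, both factors being bounded above. *)
Definition lconv (f g : int -> F) (m : int) : F :=
  \sum_(i \in [set: int]) f i * g (m - i).

Lemma lconvE (f g : int -> F) (m : int) (r : seq int) : uniq r ->
  (forall i, i \notin r -> f i * g (m - i) = 0) ->
  lconv f g m = \sum_(i <- r) f i * g (m - i).
Proof.
move=> ur r0; rewrite /lconv (fsbigE r)//.
  by apply: eq_bigl => i; rewrite in_setT.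
by move=> i _; exact: r0.
Qed.

Lemma lconv_head f g M N (l : nat) : lbound f M -> lbound g N ->
  lconv f g (M + N - l%:Z) =
  \sum_(i < l.+1) f (M - i%:Z) * g (N - (l - i)%N%:Z).
Proof.
move=> fM gN.
rewrite (@lconvE _ _ _ [seq M - i%:Z | i <- iota 0 l.+1]).
- rewrite big_map -[iota _ _]/(index_iota 0 l.+1) big_mkord.
  apply: eq_bigr => i _; congr (_ * g _).
  by have := ltn_ord i; lia.
- by rewrite map_inj_uniq ?iota_uniq// => i j; lia.
- move=> i ir; have [Mi|iM] := ltP M i; first by rewrite fM ?mul0r.
  rewrite gN ?mulr0//; rewrite ltNge; apply: contra ir => le.
  apply/mapP; exists `|M - i|%N; last by lia.
  by rewrite mem_iota; lia.
Qed.

Lemma lconv_bounded f g M N : lbound f M -> lbound g N ->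
  forall m, M + N < m -> lconv f g m = 0.
Proof.
move=> fM gN m ltm; rewrite (@lconvE _ _ _ [::]) ?big_nil// => i _.
have [Mi|iM] := ltP M i; first by rewrite fM ?mul0r.
by rewrite gN ?mulr0//; lia.
Qed.

Fact laurent_mul_bounded f g :
  exists N : int, forall m, N < m -> lconv f g m = 0.
Proof.
have [M fM] := lbound_ex f; have [N gN] := lbound_ex g.
by exists (M + N); exact: lconv_bounded.
Qed.
Definition laurent_mul f g := Laurent (laurent_mul_bounded f g).

Lemma lbound_mul f g M N : lbound f M -> lbound g N ->
  lbound (laurent_mul f g) (M + N).
Proof. exact: lconv_bounded. Qed.

(* The leading part of f in the variable t^-1, as a polynomial. *)
Definition lhead (N : int) (k : nat) f : {poly F} :=
  \poly_(i < k) f (N - i%:Z).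

Lemma coef_lhead N k f i : (i < k)%N -> (lhead N k f)`_i = f (N - i%:Z).
Proof. by move=> ik; rewrite coef_poly ik. Qed.

Lemma lhead_mul f g M N k l : lbound f M -> lbound g N -> (l < k)%N ->
  laurent_mul f g (M + N - l%:Z) = (lhead M k f * lhead N k g)`_l.
Proof.
move=> fM gN lk; rewrite /= lconv_head// coefM; apply: eq_bigr => i _.
by rewrite !coef_lhead//; have := ltn_ord i; lia.
Qed.

Lemma eq_lhead f g N : lbound f N -> lbound g N ->
  (forall l : nat, f (N - l%:Z) = g (N - l%:Z)) -> f = g.
Proof.
move=> fN gN fg; apply: laurentP => m.
have [Nm|mN] := ltP N m; first by rewrite fN ?gN.
by have := fg `|N - m|%N; rewrite (_ : N - _ = m)//; lia.
Qed.

Lemma laurent_addA : associative laurent_add.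
Proof. by move=> f g h; apply: laurentP => m /=; rewrite addrA. Qed.
Lemma laurent_addC : commutative laurent_add.
Proof. by move=> f g; apply: laurentP => m /=; rewrite addrC. Qed.
Lemma laurent_add0 : left_id laurent_zero laurent_add.
Proof. by move=> f; apply: laurentP => m /=; rewrite if_same add0r. Qed.
Lemma laurent_addN : left_inverse laurent_zero laurent_opp laurent_add.
Proof. by move=> f; apply: laurentP => m /=; rewrite if_same addNr. Qed.

HB.instance Definition _ := GRing.isZmodule.Build (laurent F)
  laurent_addA laurent_addC laurent_add0 laurent_addN.

Lemma laurent_mulC : commutative laurent_mul.
Proof.
move=> f g; have [M fM] := lbound_ex f; have [N gN] := lbound_ex g.
apply: (@eq_lhead _ _ (M + N)) => [||l].
- exact: lbound_mul.
- by rewrite addrC; exact: lbound_mul.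
- rewrite (@lhead_mul f g M N l.+1)// mulrC -(@lhead_mul g f N M l.+1)//.
  by rewrite (addrC N).
Qed.

Lemma laurent_mulA : associative laurent_mul.
Proof.
move=> f g h; have [M fM] := lbound_ex f; have [N gN] := lbound_ex g.
have [P hP] := lbound_ex h.
have fgMN := lbound_mul fM gN; have ghNP := lbound_mul gN hP.
apply: (@eq_lhead _ _ (M + N + P)) => [||l].
- by rewrite -addrA; exact: lbound_mul.
- exact: lbound_mul.
- have fl := @lhead_mul f _ M (N + P) l.+1 l fM ghNP (ltnSn l).
  rewrite addrA in fl; rewrite fl (@lhead_mul _ h (M + N) P l.+1)//.
  transitivity (lhead M l.+1 f * (lhead N l.+1 g * lhead P l.+1 h))`_l.
    rewrite !coefM; apply: eq_bigr => i _; congr (_ * _).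
    by rewrite coef_lhead ?(@lhead_mul _ _ _ _ l.+1)//; lia.
  rewrite mulrA !coefM; apply: eq_bigr => i _; congr (_ * _).
  by have := ltn_ord i => ?; rewrite coef_lhead// (@lhead_mul _ _ _ _ l.+1).
Qed.

Lemma laurent_mul1 : left_id laurent_one laurent_mul.
Proof.
move=> f; apply: laurentP => m /=; rewrite (@lconvE _ _ _ [:: 0])//.
  by rewrite big_seq1 eqxx mul1r subr0.
by move=> i; rewrite inE => /negPf ->; rewrite mul0r.
Qed.

Lemma laurent_mulDl : left_distributive laurent_mul laurent_add.
Proof.
move=> f g h; have [M fM] := lbound_ex f; have [N gN] := lbound_ex g.
have [P hP] := lbound_ex h; pose B := Num.max M N.
have fB : lbound f B by move=> m; rewrite gt_max => /andP[/fM].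
have gB : lbound g B by move=> m; rewrite gt_max => /andP[_ /gN].
have fgB : lbound (laurent_add f g) B.
  by move=> m Bm /=; rewrite fB// gB// addr0.
apply: (@eq_lhead _ _ (B + P)) => [||l].
- exact: lbound_mul.
- by move=> m Bm /=; rewrite !(@lconv_bounded _ _ B P)// addr0.
- have E k : lbound k B -> _ := fun kB => @lconv_head k h B P l kB hP.
  have -> : laurent_mul (laurent_add f g) h (B + P - l%:Z) =
    lconv (laurent_add f g) h (B + P - l%:Z) by [].
  rewrite [RHS]/= !E// -big_split; apply: eq_bigr => i _.
  exact: mulrDl.
Qed.

Lemma laurent_one_neq0 : laurent_one != 0.
Proof.
apply/eqP => /(congr1 (fun f : laurent F => f 0)) /eqP.
by rewrite /= oner_eq0.
Qed.

HB.instance Definition _ := GRing.Zmodule_isComNzRing.Build (laurent F)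
  laurent_mulA laurent_mulC laurent_mul1 laurent_mulDl laurent_one_neq0.

Lemma lcoef0 m : (0 : laurent F) m = 0.
Proof. exact: if_same. Qed.
Lemma lcoef1 m : (1 : laurent F) m = (m == 0)%:R.
Proof. by rewrite /=; case: eqP. Qed.
Lemma lcoefD f g m : (f + g) m = f m + g m.
Proof. by []. Qed.
Lemma lcoefN f m : (- f) m = - f m.
Proof. by []. Qed.
Lemma lcoefM f g m : (f * g) m = lconv f g m.
Proof. by []. Qed.

(* m is the degree of f in t. *)
Definition is_ldeg f (m : int) := f m != 0 /\ lbound f m.

Lemma is_ldeg_ex f : f != 0 -> exists m, is_ldeg f m.
Proof.
move=> f0; have [N fN] := lbound_ex f.
have exn : exists n : nat, f (N - n%:Z) != 0.
  apply: contrapT => nex; move/eqP: f0; apply.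
  apply: (@eq_lhead _ _ N) => // [m _|l]; first exact: lcoef0.
  by rewrite lcoef0; apply: contrapT => /eqP ?; apply: nex; exists l.
case: (ex_minnP exn) => n fn nmin; exists (N - n%:Z); split => // m ltm.
have [/fN //|mN] := ltP N m.
apply: contrapT => /eqP fm; have := nmin `|N - m|%N.
rewrite (_ : N - _ = m); last by lia.
by move=> /(_ fm); lia.
Qed.

Lemma is_ldeg_uniq f m k : is_ldeg f m -> is_ldeg f k -> m = k.
Proof.
move=> [fm bm] [fk bk]; apply/eqP; rewrite eq_le !leNgt.
apply/andP; split; apply/negP.
  by move=> /bk /eqP; rewrite (negPf fm).
by move=> /bm /eqP; rewrite (negPf fk).
Qed.

Lemma is_ldeg_mul f g m k : is_ldeg f m -> is_ldeg g k ->
  is_ldeg (f * g) (m + k).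
Proof.
move=> [fm bm] [gk bk]; split; last exact: lbound_mul.
have := lconv_head 0 bm bk; rewrite big_ord1 !subr0 lcoefM => ->.
by rewrite mulf_neq0.
Qed.

(* Coefficients of the inverse of f, of degree d, from the leading one down. *)
Fixpoint linv_seq f (d : int) (k : nat) : seq F :=
  if k is k'.+1 then
    let s := linv_seq f d k' in
    rcons s ((f d)^-1 *
      ((k' == 0%N)%:R - \sum_(i < k') s`_i * f (d - (k' - i)%N%:Z)))
  else [::].

Lemma linv_seqS f d k : linv_seq f d k.+1 =
  rcons (linv_seq f d k) ((f d)^-1 *
    ((k == 0%N)%:R -
      \sum_(i < k) (linv_seq f d k)`_i * f (d - (k - i)%N%:Z))).
Proof. by []. Qed.

Lemma size_linv_seq f d k : size (linv_seq f d k) = k.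
Proof. by elim: k => //= k IH; rewrite size_rcons IH. Qed.

Lemma nth_linv_seq f d k l i : (i < k)%N -> (k <= l)%N ->
  (linv_seq f d l)`_i = (linv_seq f d k)`_i.
Proof.
move=> ik /subnK <-; elim: (l - k)%N => //= n IH.
by rewrite nth_rcons size_linv_seq ltn_addl ?IH.
Qed.

Definition linv_coef f d (m : int) : F :=
  if m <= - d then (linv_seq f d `|- d - m|.+1)`_`|- d - m| else 0.

Fact linv_bounded f d :
  exists N : int, forall m, N < m -> linv_coef f d m = 0.
Proof. by exists (- d) => m ltm; rewrite /linv_coef leNgt ltm. Qed.

Lemma linv_ex f : f != 0 -> exists g, g * f = 1.
Proof.
move=> /is_ldeg_ex[d [fd bd]]; pose g := Laurent (linv_bounded f d).
have bg : lbound g (- d) by move=> m ltm; rewrite /= /linv_coef leNgt ltm.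
have gE (i : nat) : g (- d - i%:Z) = (linv_seq f d i.+1)`_i.
  rewrite /= /linv_coef ifT; last by lia.
  by rewrite (_ : `|_|%N = i)//; lia.
exists g; apply: (@eq_lhead _ _ (- d + d)) => [||l].
- exact: lbound_mul.
- by move=> m; rewrite addNr lcoef1; case: eqP => // ->; rewrite ltxx.
rewrite lcoefM lconv_head// lcoef1 addNr sub0r oppr_eq0 big_ord_recr.
under eq_bigr => i _ do rewrite gE -(@nth_linv_seq f d i.+1 l)//.
rewrite gE linv_seqS nth_rcons size_linv_seq ltnn eqxx subnn subr0.
rewrite mulrAC mulVf// mul1r.
by rewrite [LHS]addrC; exact: subrK.
Qed.

Definition laurent_inv f : laurent F := xget 0 [set g | g * f = 1].

Lemma laurent_mulV f : f != 0 -> laurent_inv f * f = 1.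
Proof.
by move=> /linv_ex[g gf]; rewrite /laurent_inv; case: xgetP => // /(_ g).
Qed.

Lemma laurent_inv0 : laurent_inv 0 = 0.
Proof.
apply: xgetPN => g /= /eqP; rewrite mulr0 eq_sym.
by apply/negP; exact: oner_neq0.
Qed.

HB.instance Definition _ := GRing.ComNzRing_isField.Build (laurent F)
  laurent_mulV laurent_inv0.

(* The inclusion of F[t] in F((t^-1)). *)
Definition laurent_of_poly_coef (p : {poly F}) (m : int) : F :=
  if m is Posz i then p`_i else 0.

Fact laurent_of_poly_bounded p :
  exists N : int, forall m, N < m -> laurent_of_poly_coef p m = 0.
Proof. by exists (size p)%:Z => -[i|i]//= lti; rewrite nth_default//; lia. Qed.
Definition laurent_of_poly p := Laurent (laurent_of_poly_bounded p).

Fact laurent_of_poly_zmod : zmod_morphism laurent_of_poly.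
Proof.
by move=> p q; apply: laurentP => -[i|i]; rewrite lcoefD lcoefN /= ?coefB ?subr0.
Qed.

Fact laurent_of_poly_monoid : monoid_morphism laurent_of_poly.
Proof.
split=> [|p q]; apply: laurentP.
  by case=> i; rewrite lcoef1 /= ?coef1.
case=> m; rewrite lcoefM; last first.
  rewrite (@lconvE _ _ _ [::]) ?big_nil// => -[i|i] _ /=; last by rewrite mul0r.
  by case E: (Negz m - i%:Z) => [j|j] /=; [lia|rewrite mulr0].
rewrite (@lconvE _ _ _ [seq i%:Z | i <- iota 0 m.+1]).
- rewrite big_map -[iota _ _]/(index_iota 0 m.+1) big_mkord /= coefM.
  apply: eq_bigr => i _; congr (_ * _); rewrite subzn//.
  by have := ltn_ord i; lia.
- by rewrite map_inj_uniq ?iota_uniq// => i j; lia.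
- case=> i ir /=; last by rewrite mul0r.
  case E: (m%:Z - i%:Z) => [j|j] /=; last by rewrite mulr0.
  by case/mapP: ir; exists i => //; rewrite mem_iota; lia.
Qed.

HB.instance Definition _ := GRing.isZmodMorphism.Build _ _
  laurent_of_poly laurent_of_poly_zmod.
HB.instance Definition _ := GRing.isMonoidMorphism.Build _ _
  laurent_of_poly laurent_of_poly_monoid.

Definition ldeg f : int := xget 0 [set m | is_ldeg f m].

Lemma ldegE f m : is_ldeg f m -> ldeg f = m.
Proof.
move=> fm; rewrite /ldeg; case: xgetP => [k _ fk|/(_ m)//].
exact: is_ldeg_uniq fk fm.
Qed.

Lemma ldegP f : f != 0 -> is_ldeg f (ldeg f).
Proof. by move=> /is_ldeg_ex[m fm]; rewrite (ldegE fm). Qed.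

End LaurentRing.

Section Norm.
Variable F : finFieldType.
Implicit Types f g : laurent F.

(* The norm takes values in {0} and the integer powers of #|F|, hence in rat. *)
Definition lnorm f : rat := if f == 0 then 0 else #|F|%:R ^ ldeg f.

Lemma card_F_gt1 : 1 < #|F|%:R :> rat.
Proof. by rewrite ltr1n card_finNzRing_gt1. Qed.

Lemma lnormE f m : is_ldeg f m -> lnorm f = #|F|%:R ^ m.
Proof.
move=> fm; rewrite /lnorm (ldegE fm); case: eqP => // f0.
by case: fm; rewrite f0 lcoef0 eqxx.
Qed.

Lemma lnorm_monom (b : F) (m : int) : b != 0 ->
  lnorm (laurent_monom b m) = #|F|%:R ^ m.
Proof.
move=> b0; apply: lnormE; split; first by rewrite /= eqxx.
by move=> k mk /=; case: eqP mk => // ->; rewrite ltxx.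
Qed.

Lemma lnormM f g : lnorm (f * g) = lnorm f * lnorm g.
Proof.
have [->|f0] := eqVneq f 0; first by rewrite mul0r /lnorm eqxx mul0r.
have [->|g0] := eqVneq g 0; first by rewrite mulr0 /lnorm eqxx mulr0.
rewrite (lnormE (is_ldeg_mul (ldegP f0) (ldegP g0))).
rewrite (lnormE (ldegP f0)) (lnormE (ldegP g0)) expfzDr//.
by rewrite gt_eqF// (lt_trans ltr01 card_F_gt1).
Qed.

Lemma lnorm_le f (N : int) : (lnorm f <= #|F|%:R ^ N) <-> lbound f N.
Proof.
have q0 : 0 < #|F|%:R :> rat := lt_trans ltr01 card_F_gt1.
have [->|f0] := eqVneq f 0.
  rewrite /lnorm eqxx exprz_ge0 ?ltW//; split=> // _ m _; exact: lcoef0.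
have fd := ldegP f0; rewrite (lnormE fd) ler_eXz2l ?card_F_gt1//.
case: fd => fd bd; split=> [le m ltm|bN]; first by apply: bd; lia.
by rewrite leNgt; apply/negP => /bN /eqP; rewrite (negPf fd).
Qed.

Lemma lnormD f g : lnorm (f + g) <= Num.max (lnorm f) (lnorm g).
Proof.
have [->|f0] := eqVneq f 0; first by rewrite add0r le_max lexx orbT.
have [->|g0] := eqVneq g 0; first by rewrite addr0 le_max lexx.
wlog le : f g f0 g0 / lnorm f <= lnorm g.
  move=> wl; have [|/ltW] := leP (lnorm f) (lnorm g) => le.
    by have := wl _ _ f0 g0 le; rewrite (max_idPr le).
  by have := wl _ _ g0 f0 le; rewrite addrC (max_idPr le).
move: (le); rewrite (max_idPr le) (lnormE (ldegP g0)).
move=> /lnorm_le bf; apply/lnorm_le => m ltm.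
by rewrite lcoefD bf// (ldegP g0).2// addr0.
Qed.

End Norm.

Definition SL (R : comNzRingType) (n : nat) : set 'M[R]_n :=
  [set g | \det g = 1].
Arguments SL R n _ : clear implicits.

Definition SLdiag (R : comNzRingType) (n : nat) : set 'M[R]_n :=
  [set a | SL R n a /\ is_diag_mx a].
Arguments SLdiag R n _ : clear implicits.

(* SL_n(o) *)
Definition SLint (F : finFieldType) (n : nat) : set 'M[laurent F]_n :=
  [set h | SL (laurent F) n h /\ forall i j, lnorm (h i j) <= 1].
Arguments SLint F n _ : clear implicits.

(* SL_n(o; p) *)
Definition SLcong (F : finFieldType) (n : nat) : set 'M[laurent F]_n :=
  [set h | SLint F n h /\
           forall i j, lnorm ((h - 1%:M : 'M[laurent F]_n) i j) < 1].
Arguments SLcong F n _ : clear implicits.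

(* SL_n(F[t]), as a subset of SL_n(F((t^-1))) *)
Definition SLpoly (F : fieldType) (n : nat) : set 'M[laurent F]_n :=
  [set map_mx (@laurent_of_poly F) g | g in SL {poly F} n].
Arguments SLpoly F n _ : clear implicits.

Definition mulset (R : pzRingType) (n : nat) (X Y : set 'M[R]_n) :
    set 'M[R]_n :=
  [set x *m y | x in X & y in Y].

(* Main.v *)
From Pilot Require Import Defs.
From mathcomp Require Import all_boot all_order all_algebra.
From mathcomp Require Import boolp classical_sets.
From mathcomp Require Import perm zify ring.
(* [lbound] must mean the degree bound, not the set of lower bounds. *)
Import Pilot.Defs.

(** A matrix [g] over [K] of determinant [1] spans the lattice of the vectors
    [g v], with [v] a vector of polynomials.  For a family of integers [m], the
    box of [m] is the set of vectors whose [i]-th coordinate has degree at most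
    [m i].  Right multiplication by [Gamma] changes the basis of the lattice, and
    left multiplication by [A] rescales the coordinates, so the theorem asks for
    a basis [W] of the lattice whose diagonal entries have larger degree than the
    other entries of their row ([dominant]).

    Such a basis comes from a maximal box that meets the lattice only in [0].
    Very small boxes have this property, as a polynomial of negative degree is
    zero.  Growing one coordinate while the others stay fixed must stop, by the
    pigeonhole principle ([dirichlet]); once it has stopped in one coordinate, it
    is still blocked there when other coordinates grow, so after one pass over
    the coordinates the box [m] is maximal ([maximal_box_free]).

    By maximality, for each [i] there is a nonzero lattice vector [w_i] in the box
    stretched by one in coordinate [i]; as [w_i] is not in the box itself, its
    [i]-th coordinate has degree exactly [m i + 1].  So the matrix [W] with
    columns [w_i] is [dominant].  It is a basis of the whole lattice, and not just
    of a sublattice: any vector [x] is [W c] for some [c] over [K], and removing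
    the polynomial parts of [c] brings [x] into the box, so a lattice vector [x]
    is reduced to [0] ([reduction_mod_box_basis]).

    It remains to normalize.  Dividing each row of [W] by its diagonal entry gives
    a matrix congruent to [1] modulo [p], whose determinant is congruent to [1]
    too, and the base change matrix has a nonzero constant determinant.
    Correcting the first diagonal entries by these two factors brings all three
    determinants to [1]. *)

Set Implicit Arguments.
Unset Strict Implicit.
Unset Printing Implicit Defensive.
Import Order.TTheory GRing.Theory Num.Theory.

Local Open Scope ring_scope.

(** * Degree bounds and polynomial parts *)

Section Degree.
Variable F : fieldType.
Implicit Types (f g : laurent F) (N : int).

Lemma lboundW f M N : M <= N -> lbound f M -> lbound f N.
Proof. by move=> MN fM m Nm; apply: fM; exact: le_lt_trans Nm. Qed.

Lemma lbound0 N : lbound (0 : laurent F) N.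
Proof. by move=> m _; exact: lcoef0. Qed.

Lemma lboundB f g N : lbound f N -> lbound g N -> lbound (f - g) N.
Proof. by move=> fN gN m Nm; rewrite lcoefD lcoefN fN// gN// subr0. Qed.

Lemma lbound_sum (I : finType) (f : I -> laurent F) N :
  (forall i, lbound (f i) N) -> lbound (\sum_i f i) N.
Proof.
move=> fN; elim/big_ind: _ => [|x y xN yN m Nm|i _]; first exact: lbound0.
  by rewrite lcoefD xN// yN// addr0.
exact: fN.
Qed.

Lemma lbound_mulmx p q r (A : 'M[laurent F]_(p, q)) (B : 'M[laurent F]_(q, r))
    M N i k :
  (forall j, lbound (A i j) M) -> (forall j, lbound (B j k) N) ->
  lbound ((A *m B) i k) (M + N).
Proof. by move=> AM BN; rewrite mxE; apply: lbound_sum => j; exact: lbound_mul. Qed.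

Lemma lbound_drop f N : lbound f N -> f N = 0 -> lbound f (N - 1).
Proof.
move=> fN f0 m Nm; have [->//|mN] := eqVneq m N.
by apply: fN; lia.
Qed.

Lemma mx_lbound_ex p q (A : 'M[laurent F]_(p, q)) :
  exists C : nat, forall i j, lbound (A i j) C%:Z.
Proof.
have [C HC] : {C : 'I_p * 'I_q -> nat &
    forall u, lbound (A u.1 u.2) (C u)%:Z}.
  apply: (@choice _ _ (fun u (C : nat) => lbound (A u.1 u.2) C%:Z)) => u.
  have [N AN] := lbound_ex (A u.1 u.2).
  by exists `|N|%N; apply: lboundW AN; lia.
exists (\max_u C u)%N => i j; apply: lboundW (HC (i, j)).
by rewrite lez_nat; apply: leq_bigmax.
Qed.

Lemma lbound_poly (p : {poly F}) (M : nat) :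
  (size p <= M.+1)%N -> lbound (laurent_of_poly p) M%:Z.
Proof.
move=> pM [k|k]//; rewrite ltz_nat => Mk /=.
by rewrite nth_default// (leq_trans pM).
Qed.

Lemma lbound_poly_eq0 (p : {poly F}) : lbound (laurent_of_poly p) (- 1) -> p = 0.
Proof. by move=> p1; apply/polyP => i; rewrite coef0; exact: (p1 i%:Z). Qed.

Lemma polynomial_part f :
  exists p : {poly F}, lbound (f - laurent_of_poly p) (- 1).
Proof.
have [N fN] := lbound_ex f; exists (\poly_(i < `|N|.+1) f i%:Z) => -[k|k]//= _.
rewrite coef_poly; case: ifP => [_|kN]; first by rewrite subrr.
by rewrite subr0 fN//; lia.
Qed.

Lemma is_ldeg1 : is_ldeg (1 : laurent F) 0.
Proof.
by split=> [|m m0]; rewrite lcoef1 ?eqxx ?oner_neq0// gt_eqF.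
Qed.

Lemma is_ldeg_neq0 f d : is_ldeg f d -> f != 0.
Proof. by move=> [fd _]; apply: contra_neq fd => ->; rewrite lcoef0. Qed.

Lemma is_ldegV f d : is_ldeg f d -> is_ldeg f^-1 (- d).
Proof.
move=> fd; have f0 := is_ldeg_neq0 fd.
have fV0 : f^-1 != 0 by rewrite invr_eq0.
have [u fu] := is_ldeg_ex fV0; have := is_ldeg_mul fd fu.
by rewrite divff// => /is_ldeg_uniq/(_ is_ldeg1)/eqP; rewrite addr_eq0 =>
  /eqP ->; rewrite opprK.
Qed.

End Degree.

(** * Reduction modulo the maximal ideal *)

Section Residue.
Variable F : fieldType.
Implicit Types (f g : laurent F) (a b c : F).

(** [f] lies in the valuation ring and reduces to [a] in the residue field,
    the residue being read off as the coefficient of [t^0].  A relation between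
    [f] and [a] lets reduction be propagated through sums and products without a
    ring structure on the valuation ring. *)
Definition has_residue f a := lbound f 0 /\ f 0 = a.

Lemma has_residue0 : has_residue 0 0.
Proof. by split; [exact: lbound0 | exact: lcoef0]. Qed.

Lemma has_residue1 : has_residue 1 1.
Proof. by split; [exact: (is_ldeg1 F).2 | rewrite lcoef1 eqxx]. Qed.

Lemma has_residueN f a : has_residue f a -> has_residue (- f) (- a).
Proof.
by move=> [bf <-]; split=> [m m0|]; rewrite lcoefN// bf// oppr0.
Qed.

Lemma has_residueD f g a b :
  has_residue f a -> has_residue g b -> has_residue (f + g) (a + b).
Proof.
by move=> [bf <-] [bg <-]; split=> [m m0|]; rewrite lcoefD// bf// bg// addr0.
Qed.

Lemma has_residueM f g a b :
  has_residue f a -> has_residue g b -> has_residue (f * g) (a * b).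
Proof.
move=> [bf <-] [bg <-]; split; first exact: (lbound_mul bf bg).
by have := lconv_head 0 bf bg; rewrite big_ord1 !subr0 lcoefM.
Qed.

Lemma has_residue_neq0 f a : a != 0 -> has_residue f a -> f != 0.
Proof.
by move=> a0 [_ fa]; apply: contra_neq a0 => f0; rewrite -fa f0 lcoef0.
Qed.

Lemma has_residueV f a : a != 0 -> has_residue f a -> has_residue f^-1 a^-1.
Proof.
move=> a0 fr; have [bf fa] := fr; have fd : is_ldeg f 0 by split=> //; rewrite fa.
have bV : lbound f^-1 0 by have [] := is_ldegV fd; rewrite oppr0.
have [_] := has_residueM fr (conj bV (erefl _)).
rewrite divff ?(has_residue_neq0 a0 fr)// (has_residue1).2 => aV.
by split=> //; apply: (mulfI a0); rewrite -aV divff.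
Qed.

Lemma has_residueC c : has_residue (laurent_of_poly c%:P) c.
Proof.
split; last by rewrite /= coefC.
by apply: (@lbound_poly _ _ 0); exact: size_polyC_leq1.
Qed.

Lemma has_residue_det n (h : 'M[laurent F]_n) (r : 'M[F]_n) :
  (forall i j, has_residue (h i j) (r i j)) -> has_residue (\det h) (\det r).
Proof.
move=> hr; apply: (big_ind2 has_residue) => [|x a y b|s _].
- exact: has_residue0.
- exact: has_residueD.
- apply: has_residueM; last first.
    apply: (big_ind2 has_residue) => [|x a y b|i _]; last exact: hr.
      exact: has_residue1.
    exact: has_residueM.
  case: (s : bool); rewrite ?expr1 ?expr0; last exact: has_residue1.
  by apply: has_residueN; exact: has_residue1.
Qed.

End Residue.

(** * Dominant matrices *)

Section Dominant.
Variables (F : fieldType) (n : nat).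
Implicit Types (W : 'M[laurent F]_n) (m : 'I_n -> int).

Definition dominant W m := forall i,
  is_ldeg (W i i) (m i + 1) /\ forall j, i != j -> lbound (W i j) (m i).

Definition row_normalize W := \matrix_(i, j) (W i j / W i i).

Lemma dominant_diag_neq0 W m i : dominant W m -> W i i != 0.
Proof. by move=> /(_ i)[/is_ldeg_neq0]. Qed.

Lemma dominant_factor W m :
  dominant W m -> W = diag_mx (\row_i W i i) *m row_normalize W.
Proof.
move=> Wm; apply/matrixP => i j.
by rewrite mul_diag_mx !mxE mulrCA divff ?mulr1// (dominant_diag_neq0 i Wm).
Qed.

(** Off the diagonal, the degree drops by at least one in the division. *)
Lemma row_normalize_residue W m i j :
  dominant W m -> has_residue (row_normalize W i j) (i == j)%:R.
Proof.
move=> Wm; have [Wi Wij] := Wm i; rewrite mxE; case: eqVneq => [<-|ij].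
  by rewrite divff ?(dominant_diag_neq0 i Wm)//; exact: has_residue1.
have b := lbound_mul (Wij _ ij) (is_ldegV Wi).2.
by split; [apply: lboundW b; lia | apply: b; lia].
Qed.

Lemma det_row_normalize_residue W m :
  dominant W m -> has_residue (\det (row_normalize W)) 1.
Proof.
move=> Wm; rewrite -(det1 F n); apply: has_residue_det => i j.
by rewrite [X in has_residue _ X]mxE; exact: row_normalize_residue Wm.
Qed.

Lemma dominant_unit W m : dominant W m -> W \in unitmx.
Proof.
move=> Wm; rewrite unitmxE unitfE (dominant_factor Wm) det_mulmx det_diag.
rewrite mulf_neq0//.
  by apply/prodf_neq0 => i _; rewrite mxE (dominant_diag_neq0 i Wm).
exact: has_residue_neq0 (oner_neq0 _) (det_row_normalize_residue Wm).
Qed.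

End Dominant.

(** * Boxes that meet the lattice only in zero *)

Section Boxes.
Variables (F : finFieldType) (n : nat).
Implicit Types (g W : 'M[laurent F]_n) (m : 'I_n -> int).

Definition in_box m (x : 'cV[laurent F]_n) := forall i, lbound (x i 0) (m i).

(** Freeness is expressed on coordinate vectors [v]: when [g] is invertible, a
    nonzero [v] is the same thing as a nonzero lattice vector [g v]. *)
Definition box_free g m := forall v : 'cV[{poly F}]_n,
  in_box m (g *m map_mx (@laurent_of_poly F) v) -> v = 0.

Definition stretch m (i : 'I_n) (k : nat) : 'I_n -> int :=
  fun j => m j + (if j == i then k%:Z else 0).

Lemma box_freeW g m m' : (forall i, m i <= m' i) -> box_free g m' -> box_free g m.
Proof. by move=> mm' fr v vm; apply: fr => i; apply: lboundW (vm i). Qed.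

(** The entries of [invmx g] bound how much a lattice vector can shrink: if [g v]
    is small enough, then the polynomials [v i] have negative degree. *)
Lemma box_free_ex g : g \in unitmx -> exists m, box_free g m.
Proof.
move=> gU; have [C gC] := mx_lbound_ex (invmx g).
exists (fun _ => - C%:Z - 1) => v vm; apply/matrixP => i j; rewrite !mxE.
apply: lbound_poly_eq0; rewrite ord1.
have -> : laurent_of_poly (v i 0) =
    (invmx g *m (g *m map_mx (@laurent_of_poly F) v)) i 0.
  by rewrite mulKmx// mxE.
rewrite (_ : - 1 = C%:Z + (- C%:Z - 1)); last by lia.
by apply: lbound_mulmx.
Qed.

(** Euclidean division by [W].  If [W C = g] and [P] is the polynomial part of [C],
    the columns of [W (P - C)] are lattice vectors, and they lie in the box because
    [P - C] has entries of negative degree; so they vanish, and [V P = 1]. *)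
Lemma reduction_mod_box_basis g W (V : 'M[{poly F}]_n) m :
  W = g *m map_mx (@laurent_of_poly F) V -> W \in unitmx ->
  (forall i j, lbound (W i j) (m i + 1)) -> box_free g m ->
  exists P, V *m P = 1%:M.
Proof.
move=> WE WU Wb fr.
have [C WC] : exists C, W *m C = g.
  by exists (invmx W *m g); rewrite mulKVmx.
have [p pP] : {p : 'I_n * 'I_n -> {poly F} &
    forall u, lbound (C u.1 u.2 - laurent_of_poly (p u)) (- 1)}.
  apply: (@choice _ _ (fun u q =>
    lbound (C u.1 u.2 - laurent_of_poly q) (- 1))) => u.
  exact: polynomial_part.
pose P : 'M[{poly F}]_n := \matrix_(i, j) p (i, j).
have reduced : g *m map_mx (@laurent_of_poly F) (V *m P - 1%:M) =
    W *m (map_mx (@laurent_of_poly F) P - C).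
  by rewrite map_mxB map_mxM map_mx1 !mulmxBr mulmxA -WE mulmx1 WC.
exists P; apply/subr0_eq/matrixP => i k.
suff: col k (V *m P - 1%:M) = 0 by move/matrixP => /(_ i 0); rewrite !mxE.
apply: fr => j; rewrite map_col colE mulmxA reduced -colE.
rewrite mxE; have -> : m j = (m j + 1) + (- 1) by lia.
apply: lbound_mulmx => // l; rewrite !mxE -opprB.
by move=> q q1; rewrite lcoefN; have /= -> := pP (l, k) q q1; rewrite oppr0.
Qed.

End Boxes.

(** Dirichlet's theorem.  Consider the vectors [v] of polynomials of degree less
    than [M].  The coordinates of [g v] other than the [i]-th have at most
    [n (M + C + B)] coefficients above degree [- B], a lower bound for [m], while
    [v] has [(n + 1) M] coefficients.  For [M] large two vectors agree in all
    the former, and their difference gives a lattice vector whose only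
    unconstrained coordinate is the [i]-th. *)
Lemma dirichlet (F : finFieldType) n (g : 'M[laurent F]_n.+1) m i :
  exists k, ~ box_free g (stretch m i k).
Proof.
have [C gC] := mx_lbound_ex g.
have [B mB] : exists B : nat, forall j, - B%:Z <= m j.
  exists (\max_j `|m j|)%N => j.
  have : (`|m j| <= \max_j `|m j|)%N by apply: leq_bigmax.
  by lia.
(* The least [M] with [n * (M + C + B) < n.+1 * M]. *)
pose M := (n * (C + B)).+1; pose K := (M + C + B)%N.
pose vec (x : {ffun 'I_n.+1 * 'I_M -> F}) : 'cV[{poly F}]_n.+1 :=
  \col_j \poly_(l < M) x (j, inord l).
pose gv (v : 'cV_n.+1) := g *m map_mx (@laurent_of_poly F) v.
pose top (x : {ffun 'I_n.+1 * 'I_M -> F}) : {ffun 'I_n * 'I_K -> F} :=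
  [ffun u : 'I_n * 'I_K => (gv (vec x) (lift i u.1) 0) (C%:Z + M%:Z - (u.2 : nat)%:Z)].
have topI : ~ injective top.
  move=> /leq_card; apply/negP; rewrite -ltnNge !card_ffun !card_prod !card_ord.
  rewrite ltn_exp2l ?card_finNzRing_gt1// /K /M; nia.
have [x [y [xy txy]]] : exists x y, x <> y /\ top x = top y.
  apply: contrapT => nex; apply: topI => x y txy; apply: contrapT => xy.
  by apply: nex; exists x, y.
have bvec j z : lbound (gv (vec z) j 0) (C%:Z + M%:Z).
  apply: lbound_mulmx => // l; rewrite !mxE; apply: lbound_poly.
  by apply: leq_trans (size_poly _ _) _.
exists (C + M + `|m i|)%N => fr.
apply: xy; apply/ffunP => -[j l].
have /matrixP/(_ j 0) : vec x - vec y = 0.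
  apply: fr => k; rewrite map_mxB mulmxBr -/(gv _) -/(gv _) mxE [X in _ + X]mxE.
  rewrite /stretch; case: eqP => [->|/eqP ki].
    by apply: lboundB; apply: lboundW (bvec _ _); lia.
  rewrite addr0 => q mq; rewrite lcoefD lcoefN; apply/eqP; rewrite subr_eq0.
  have [qCM|qCM] := ltP (C%:Z + M%:Z) q; first by rewrite !bvec.
  have [k' kE|kE] := unliftP i k; last by rewrite kE eqxx in ki.
  have Kl : (`|(C%:Z + M%:Z - q)%R| < K)%N.
    by have := mB k; rewrite /K; lia.
  move/ffunP: txy => /(_ (k', Ordinal Kl)); rewrite !ffunE /= -kE.
  by rewrite (_ : C%:Z + M%:Z - _ = q) => [->//|]; lia.
rewrite !mxE => /eqP; rewrite subr_eq0 => /eqP/polyP/(_ l).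
by rewrite !coef_poly ltn_ord inord_val.
Qed.

(** Each coordinate is stretched as far as possible, in turn.  Freeness passes to
    smaller boxes, so a coordinate that is blocked remains so in all larger boxes
    and is never treated again. *)
Lemma maximal_box_free (F : finFieldType) n (g : 'M[laurent F]_n.+1) :
  g \in unitmx ->
  exists2 m, box_free g m & forall i, ~ box_free g (stretch m i 1).
Proof.
move=> gU; suff [m fr mm] : exists2 m, box_free g m &
    forall i, i \in enum 'I_n.+1 -> ~ box_free g (stretch m i 1).
  by exists m => // i; apply: mm; rewrite mem_enum.
elim: (enum _) => [|i s [m fr mm]].
  by have [m fr] := box_free_ex gU; exists m.
have exk : exists k, ~~ `[< box_free g (stretch m i k) >].
  by have [k /asboolPn] := dirichlet g m i; exists k.
case: (ex_minnP exk) => -[|k] /asboolPn nfr kmin.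
  by case: nfr; apply: box_freeW fr => j; rewrite /stretch; case: ifP; lia.
exists (stretch m i k).
  apply: contrapT => /asboolPn /kmin; by rewrite ltnn.
move=> j; rewrite inE => /orP[/eqP ->|/mm nfrj] fr'.
  by apply: nfr; apply: box_freeW fr' => l; rewrite /stretch; case: ifP; lia.
apply: nfrj; apply: box_freeW fr' => l; rewrite /stretch.
by do 2![case: ifP]; lia.
Qed.


(** The columns of [W] are nonzero lattice vectors [g (v i)] witnessing that the
    maximal box cannot be stretched in coordinate [i].  The coefficient of
    [W i i] in degree [m i + 1] is nonzero, as otherwise [g (v i)] would lie in the
    box itself. *)
Lemma dominant_basis (F : finFieldType) n (g : 'M[laurent F]_n.+1) :
  g \in unitmx ->
  exists W P m, [/\ g = W *m map_mx (@laurent_of_poly F) P,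
    P \in unitmx & dominant W m].
Proof.
move=> gU; have [m fr mm] := maximal_box_free gU.
have [v vP] : {v : 'I_n.+1 -> 'cV[{poly F}]_n.+1 & forall i,
    in_box (stretch m i 1) (g *m map_mx (@laurent_of_poly F) (v i)) /\
    v i <> 0}.
  apply: (@choice _ _ (fun i v => in_box (stretch m i 1)
    (g *m map_mx (@laurent_of_poly F) v) /\ v <> 0)) => i; apply: contrapT => nex; apply: (mm i) => v vi.
  by apply: contrapT => v0; apply: nex; exists v.
pose V := \matrix_(i, j) v j i 0; pose W := g *m map_mx (@laurent_of_poly F) V.
have WE i j : W i j = (g *m map_mx (@laurent_of_poly F) (v j)) i 0.
  by rewrite !mxE; apply: eq_bigr => k _; rewrite !mxE.
have Wm : dominant W m.
  move=> i; split=> [|j ij]; last first.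
    by have := (vP j).1 i; rewrite -WE /stretch (negPf ij) addr0.
  have Wii : lbound (W i i) (m i + 1).
    by have := (vP i).1 i; rewrite -WE /stretch eqxx.
  split=> //; apply/eqP => W0; apply: (vP i).2; apply: fr => j; rewrite -WE.
  have [->|ji] := eqVneq j i.
    by have := lbound_drop Wii W0; rewrite addrK.
  by have := (vP i).1 j; rewrite -WE /stretch (negPf ji) addr0.
have Wb i j : lbound (W i j) (m i + 1).
  have [[_ Wi] Wij] := Wm i; have [<-//|ij] := eqVneq i j.
  by apply: lboundW (Wij _ ij); lia.
have [P VP] := reduction_mod_box_basis (erefl W) (dominant_unit Wm) Wb fr.
exists W, P, m; split=> //; last by have [_] := mulmx1_unit VP.
by rewrite /W -mulmxA -map_mxM VP map_mx1 mulmx1.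
Qed.

(** * The decomposition *)

Lemma SLcong_residue (F : finFieldType) n (h : 'M[laurent F]_n) : \det h = 1 ->
  (forall i j, has_residue (h i j) (i == j)%:R) -> SLcong F n h.
Proof.
move=> h1 hr; split; first by split=> // i j; apply/(lnorm_le _ 0); case: (hr i j).
move=> i j; apply: (@le_lt_trans _ _ (#|F|%:R ^ (-1))); last first.
  by rewrite -[1](expr0z #|F|%:R) ltr_eXz2l// card_F_gt1.
apply/lnorm_le; have [hb hE] := hr i j; apply: (@lbound_drop _ _ 0).
  move=> k k0; rewrite !mxE lcoefD lcoefN hb//.
  by case: eqP => _; rewrite ?lcoef0 ?lcoef1 ?(gt_eqF k0) subr0.
by rewrite !mxE lcoefD lcoefN hE; case: eqP => _; rewrite ?lcoef0 ?lcoef1 subrr.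
Qed.

Theorem theorem1p3 (F : finFieldType) (n : nat) (hn : (2 <= n)%N) :
  SL (laurent F) n =
  mulset (mulset (SLdiag (laurent F) n) (SLcong F n)) (SLpoly F n).
Proof.
apply/seteqP; split=> [g g1|_ [_ [a [a1 _] [h [[h1 _] _] <-]] [_ [y y1 <-] <-]]];
    last first.
  by rewrite /SL /= !det_mulmx a1 h1 det_map_mx y1 rmorph1 !mulr1.
case: n hn g g1 => // n _ g g1.
have gU : g \in unitmx by rewrite unitmxE g1 unitr1.
have [W [P [m [gE PU Wm]]]] := dominant_basis gU.
have [e e0 eE] : exists2 e, e != 0 & \det P = e%:P.
  move: PU; rewrite unitmxE poly_unitE => /andP[/size_poly1P[e e0 ->] _].
  by exists e.
have [h0 [Wh0 h0r ur]] : exists h0, [/\ W = diag_mx (\row_i W i i) *m h0,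
    forall i j, has_residue (h0 i j) (i == j)%:R & has_residue (\det h0) 1].
  exists (row_normalize W); split; first exact: dominant_factor Wm.
    by move=> i j; exact: row_normalize_residue Wm.
  exact: det_row_normalize_residue Wm.
pose u := \det h0.
pose c (x : F) := laurent_of_poly x%:P.
(* Multiplying [P] by [diag d] and dividing [h0] by [diag s] brings their
   determinants to [1].  Both are compensated for in [a]; to get there, [diag d]
   must be moved across [h0], which is thereby conjugated and so stays congruent
   to [1]. *)
pose d (i : 'I_n.+1) : F := if i == 0 then e^-1 else 1.
pose s (i : 'I_n.+1) : laurent F := if i == 0 then u else 1.
have d0 i : d i != 0 by rewrite /d; case: ifP => _; rewrite ?invr_eq0 ?oner_eq0.
have u0 : u != 0 by exact: has_residue_neq0 (oner_neq0 _) ur.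
have s0 i : s i != 0 by rewrite /s; case: ifP => _; rewrite ?oner_eq0.
have prod_first (R : comNzRingType) (x : R) :
    \prod_(i < n.+1) (if i == 0 then x else 1) = x.
  by rewrite (bigD1 0)//= big1 ?mulr1// => i /negPf ->.
have detD : \det (diag_mx (\row_i (d i)%:P)) = (e^-1)%:P.
  rewrite det_diag -[RHS]prod_first; apply: eq_bigr => i _.
  by rewrite !mxE /d; case: eqP.
pose a := diag_mx (\row_i (W i i * (s i * (c (d i))^-1))).
pose h := diag_mx (\row_i ((s i)^-1 * c (d i))) *m h0 *m
  diag_mx (\row_i (c (d i))^-1).
have hE i j : h i j = (s i)^-1 * c (d i) * h0 i j * (c (d j))^-1.
  by rewrite /h mul_mx_diag mxE mul_diag_mx !mxE.
pose y := diag_mx (\row_i (d i)%:P) *m P.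
have cd0 i : c (d i) != 0 by exact: has_residue_neq0 (has_residueC _).
have y1 : \det y = 1 by rewrite det_mulmx detD eE -polyCM mulVf.
have rescaling_cancels (w b x z t : laurent F) : x != 0 -> z != 0 -> t != 0 ->
    w * b = w * (t * x^-1) * (t^-1 * x * b * z^-1) * z.
  by move=> x0 z0 t0; field; rewrite x0 z0 t0.
have gf : g = a *m h *m map_mx (@laurent_of_poly F) y.
  rewrite map_mxM mulmxA gE; congr (_ *m _).
  rewrite map_diag_mx; apply/matrixP => i j.
  have -> : W i j = W i i * h0 i j by rewrite {1}Wh0 mul_diag_mx !mxE.
  rewrite mul_mx_diag mxE mul_diag_mx mxE hE !mxE -/(c _).
  exact: (rescaling_cancels _ _ _ _ _ (cd0 i) (cd0 j) (s0 i)).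
have h1 : \det h = 1.
  rewrite !det_mulmx !det_diag -/u.
  under eq_bigr => i _ do rewrite mxE.
  under [X in _ * X]eq_bigr => i _ do rewrite mxE.
  rewrite big_split /= !prodfV prod_first.
  have : \prod_i c (d i) != 0 by apply/prodf_neq0.
  by move: (\prod_i _) u0; clear => x u0 x0; field; rewrite x0.
have a1 : \det a = 1.
  have detg : \det g = 1 by exact: g1.
  by move: detg; rewrite gf 2!det_mulmx h1 det_map_mx y1 rmorph1 !mulr1.
have hr i j : has_residue (h i j) (i == j)%:R.
  have sr : has_residue (s i)^-1 1.
    rewrite -[1 in X in has_residue _ X]invr1.
    apply: has_residueV; first exact: oner_neq0.
    rewrite /s; case: eqP => _; last exact: has_residue1.
    exact: ur.
  have -> : (i == j)%:R = 1 * d i * (i == j)%:R * (d j)^-1.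
    by case: eqVneq => [->|_]; rewrite ?mulr0 ?mul0r// mul1r mulr1 divff.
  rewrite hE; apply: has_residueM.
    apply: has_residueM; last exact: h0r.
    by apply: has_residueM => //; exact: has_residueC.
  by apply: has_residueV => //; exact: has_residueC.
rewrite gf; exists (a *m h).
  exists a; first by split=> //; exact: diag_mx_is_diag.
  by exists h => //; exact: SLcong_residue.
by exists (map_mx (@laurent_of_poly F) y) => //; exists y.
Qed.
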